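(* For each $$r \in \{41, 57, 73, 89, 113, 121, 129, 137, 153, 161, 169, 177, 181, 189, 193, 197\},$$ there exists a pentagonal geometry $\mathrm{PENT}(4,r)$ with a connected deficiency graph of girth at least $5$.
   Context: A partial linear space is a (finite) set of points together with a set of lines, each line identified with the set of points incident with it, such that two distinct points lie on at most one common line. Two points are collinear if some line contains both (so a point that lies on a line is collinear with itself). A pentagonal geometry $\mathrm{PENT}(k,r)$ is a partial linear space in which every line has exactly $k$ points, every point is on exactly $r$ lines, and for every point $x$ the set of points not collinear with $x$ is (the point set of) a line of the geometry. Its deficiency graph has the points of the geometry as vertices, with $x \sim y$ precisely when $x$ and $y$ are not collinear. *)

(* Defs.v *)
From mathcomp Require Import all_boot.

Set Implicit Arguments.
Unset Strict Implicit.
Unset Printing Implicit Defensive.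

Section Geometry.

Variables (T : finType) (L : {set {set T}}).

Definition partial_linear_space : Prop :=
  forall (l1 l2 : {set T}) (x y : T),
    l1 \in L -> l2 \in L -> x != y ->
    x \in l1 -> y \in l1 -> x \in l2 -> y \in l2 -> l1 = l2.

Definition collinear : rel T :=
  fun x y => [exists l in L, (x \in l) && (y \in l)].

Definition pentagonal_geometry (k r : nat) : Prop :=
  [/\ partial_linear_space,
      forall l : {set T}, l \in L -> #|l| = k,
      forall x : T, #|[set l in L | x \in l]| = r &
      forall x : T, [set y | ~~ collinear x y] \in L].

Definition deficiency_graph : rel T := fun x y => ~~ collinear x y.

End Geometry.

Section Graph.

Variables (T : finType) (e : rel T).

(* The graph with no vertices is not connected; this also keeps the geometry
   with no points, which is vacuously pentagonal for all parameters, from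
   having a connected deficiency graph. *)
Definition connected_graph : Prop :=
  0 < #|T| /\ forall x y : T, connect e x y.

(* [ucycle] also accepts sequences of fewer than three vertices, which are not
   cycles of a simple graph. *)
Definition graph_cycle (c : seq T) : Prop := ucycle e c /\ 3 <= size c.

(* An acyclic graph has infinite girth. *)
Definition girth_at_least (g : nat) : Prop :=
  forall c : seq T, graph_cycle c -> g <= size c.

End Graph.

(* Main.v *)
From Stdlib Require Import NArith Lia.
Require Import Defs.
From mathcomp Require Import all_boot.
From mathcomp Require Import ssralg fingroup perm zmodp.

Set Implicit Arguments.
Unset Strict Implicit.
Unset Printing Implicit Defensive.

(** A pentagonal geometry PENT(4, r) has 3r + 5 points.  For the values of [r]
    at hand 3r + 5 = 4n, and an explicit geometry is given for each of them on
    the points (x, i) with x in Z_n and i in {0, 1, 2, 3}, invariant under the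
    translations x |-> x + t.  The point (x, i) is the number 4x + i modulo 4n,
    so that the translations are the additions of multiples of 4.  The lines
    are the translates of a few base blocks of three kinds.

    - The deficiency graph is bipartite between the classes i < 2 and i >= 2.
      Read i as a pair of bits (a, e); then (x, 0, e) is joined to
      (x + s, 1, e + e') for the four elements (s, e') of a subset S of
      Z_n x Z_2.  The neighbourhoods of the points are lines.
    - A partial difference family: base blocks {a, b, c, d} of Z_n whose
      differences are distinct.  Identify {0, 1, 2, 3} with GF(4), and let w
      be a generator of its multiplicative group.  Each such block
      yields the 16 blocks (a, i), (b, j), (c, i + j), (d, i + w j).  Any two of
      i, j, i + j, i + w j determine i and j, so these blocks join each (x, i)
      to each (x + t, j), once, for all the differences t of the family.
    - A small core of further blocks, which joins the remaining pairs: those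
      whose difference in Z_n lies outside the family and that are neither
      adjacent in the graph nor at distance 2.  If the core is confined to
      differences in short intervals around 0, and around n / 2 when n is even,
      then it does not depend on n, and one core serves several geometries.

    Because of the translations, all that has to be checked is that, for each of
    the four points c = 0, 1, 2, 3, every other point is either a neighbour of c
    or on exactly one of the lines through c ([star_ok]); this is a computation
    on lists of at most 596 binary numbers.  Connectedness is also reduced by
    translation, to a walk from 0 through 1, 2, 3 and 4 ([walk_ok]).

    The girth needs no computation.  There is no triangle, since the neighbours
    of a point are collinear.  A 4-cycle would give two points with two common
    neighbours, hence with the same opposite line, and then the connected
    component of these points would consist of the 2k points of two lines
    ([opposite_inj]). *)

(** * Opposite lines and girth *)

Section Opposites.
Variables (T : finType) (L : {set {set T}}).
Local Notation e := (deficiency_graph L).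
Definition opposite (x : T) : {set T} := [set y | ~~ collinear L x y].

Lemma collinearC x y : collinear L x y = collinear L y x.
Proof. by apply: eq_existsb => l; rewrite [(x \in l) && _]andbC. Qed.

Lemma deficiencyC : symmetric e.
Proof. by move=> x y; rewrite /deficiency_graph collinearC. Qed.

Lemma in_opposite x y : (y \in opposite x) = e x y.
Proof. by rewrite inE. Qed.

Lemma oppositeC x y : (y \in opposite x) = (x \in opposite y).
Proof. by rewrite !in_opposite deficiencyC. Qed.

Section Geometry.
Variables (k r : nat).
Hypotheses (LP : pentagonal_geometry L k r) (k_gt1 : 1 < k).

Lemma opposite_line x : opposite x \in L.
Proof. by case: LP => _ _ _; apply. Qed.

Lemma card_opposite x : #|opposite x| = k.
Proof. by case: LP => _ Lk _ _; apply/Lk/opposite_line. Qed.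

Lemma eq_opposite x x' y z : y != z ->
  y \in opposite x -> z \in opposite x ->
  y \in opposite x' -> z \in opposite x' -> opposite x = opposite x'.
Proof.
case: LP => pls _ _ _ neq yx zx yx' zx'.
exact: (pls _ _ y z (opposite_line x) (opposite_line x')).
Qed.

(** If [x] and [x'] have the same opposite line l, then all the points of l are
    adjacent to both [x] and [x'] and hence have one and the same opposite line
    m.  So l and m are joined completely and form a connected component. *)
Lemma opposite_inj :
  connected_graph e -> 2 * k < #|T| -> injective opposite.
Proof.
move=> [_ conn] ltT x x' eqx; apply/eqP/negPn/negP => neq.
have eqN a a' : a \in opposite x -> a' \in opposite x ->
    opposite a = opposite a'.
  move=> ax ax'; have ay := ax; have ay' := ax'; rewrite eqx in ay ay'.
  by apply: (eq_opposite neq); rewrite oppositeC.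
have [a ax] : exists a, a \in opposite x.
  by apply/card_gt0P; rewrite card_opposite (ltn_trans _ k_gt1).
have clD : closed e (mem (opposite x :|: opposite a)).
  apply: intro_closed; first exact/sym_connect_sym/deficiencyC.
  move=> y z eyz; rewrite !in_setU => /orP[yx | ya]; apply/orP.
    by right; rewrite (eqN _ _ ax yx) in_opposite.
  left; have [b [b' [bx bx' neqb]]] :
      exists b b', [/\ b \in opposite x, b' \in opposite x & b != b'].
    have /card_gt1P[b [b' [? ? ?]]] : 1 < #|opposite x|.
      by rewrite card_opposite.
    by exists b, b'.
  suff -> : opposite x = opposite y by rewrite in_opposite.
  by apply: (eq_opposite neqb) => //; rewrite oppositeC -(eqN a).
have : #|T| <= #|opposite x :|: opposite a|.
  apply/subset_leq_card/subsetP => y _.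
  by rewrite -(closed_connect clD (conn a y)) in_setU ax.
apply/negP; rewrite -ltnNge (leq_ltn_trans _ ltT) //.
by rewrite mul2n -addnn -{1}(card_opposite x) -(card_opposite a) leq_card_setU.
Qed.

(** A triangle is excluded because the neighbours of a point are collinear, and
    a 4-cycle because its diagonals [a c] and [b d] would give
    [opposite a = opposite c]. *)
Lemma girth5 :
  connected_graph e -> 2 * k < #|T| -> girth_at_least e 5.
Proof.
move=> conn ltT c [/andP[cyc uniqc] sz]; rewrite leqNgt; apply/negP => szc.
have adj_opp x y z : e x y -> e x z -> ~~ e y z.
  move=> exy exz; rewrite /deficiency_graph negbK; apply/existsP.
  by exists (opposite x); rewrite opposite_line !in_opposite exy.
case: c cyc uniqc sz szc => [|a [|b [|c [|d [|? ?]]]]] //=.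
  case/and4P=> eab ebc eca _ _ _ _.
  by have := adj_opp _ _ _ eab; rewrite deficiencyC in eca;
     move=> /(_ _ eca); rewrite ebc.
case/and5P=> eab ebc ecd eda _; rewrite !inE !negb_or -!andbA.
case/and3P=> _ ac /and3P[_ _ /andP[bd _]] _ _; case/eqP: ac.
apply: (opposite_inj conn ltT); apply: (eq_opposite bd).
- by rewrite in_opposite.
- by rewrite in_opposite deficiencyC.
- by rewrite in_opposite deficiencyC.
- by rewrite in_opposite.
Qed.
End Geometry.
End Opposites.

(** * Automorphisms *)

Section Automorphisms.
Variables (T : finType) (L : {set {set T}}).

Definition automorphism (f : {perm T}) : Prop :=
  forall l : {set T}, (f @: l \in L) = (l \in L).

Lemma perm_preimK (f : {perm T}) (l : {set T}) : f @: (f @^-1: l) = l.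
Proof.
by apply/setP=> z; rewrite -[z](permKV f) (mem_imset _ _ perm_inj) inE.
Qed.

Lemma collinear_aut f x y :
  automorphism f -> collinear L (f x) (f y) = collinear L x y.
Proof.
move=> autf; apply/existsP/existsP => -[l /and3P[lL xl yl]]; last first.
  by exists (f @: l); rewrite autf lL !(mem_imset _ _ perm_inj) xl.
by exists (f @^-1: l); rewrite !inE xl yl -autf perm_preimK lL.
Qed.

Lemma connect_aut f x y : automorphism f ->
  connect (deficiency_graph L) x y -> connect (deficiency_graph L) (f x) (f y).
Proof.
move=> autf /connectP[p xp ->]; rewrite -last_map; apply/connectP.
exists (map f p) => //; apply: homo_path xp => a b.
by rewrite /deficiency_graph collinear_aut.
Qed.

Lemma opposite_aut f x : automorphism f -> opposite L (f x) = f @: opposite L x.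
Proof.
move=> autf; apply/setP=> y; rewrite -[y](permKV f) (mem_imset _ _ perm_inj).
by rewrite !inE collinear_aut.
Qed.

Lemma card_lines_aut f x : automorphism f ->
  #|[set l in L | f x \in l]| = #|[set l in L | x \in l]|.
Proof.
move=> autf; set Lx := [set l in L | x \in l].
rewrite -(card_imset Lx (imset_inj (@perm_inj _ f))).
apply: eq_card => l; rewrite !inE; apply/andP/imsetP => [[lL fxl] | [m mL ->]].
  by exists (f @^-1: l); rewrite ?perm_preimK // !inE fxl -autf perm_preimK lL.
by move: mL; rewrite inE autf (mem_imset _ _ perm_inj) => /andP[].
Qed.

(** The axioms only have to be verified at representatives [C] of the point
    orbits. *)
Lemma pentagonal_aut k r (C : T -> Prop) :
    (forall l, l \in L -> #|l| = k) ->
    (forall x, exists c f, [/\ C c, automorphism f & f c = x]) ->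
    (forall c, C c -> #|[set l in L | c \in l]| = r) ->
    (forall c, C c -> opposite L c \in L) ->
    (forall (l1 l2 : {set T}) c y, C c -> l1 \in L -> l2 \in L -> c != y ->
      c \in l1 -> y \in l1 -> c \in l2 -> y \in l2 -> l1 = l2) ->
  pentagonal_geometry L k r.
Proof.
move=> Lk orb Cr Copp Cmeet; split=> // [l1 l2 x y|x|x]; last first.
- have [c [f [cC autf <-]]] := orb x.
  by rewrite -[[set y | _]]/(opposite L _) opposite_aut // autf Copp.
- have [c [f [cC autf <-]]] := orb x.
  by rewrite card_lines_aut ?Cr.
have [c [f [cC autf <-]]] := orb x.
rewrite -[y](permKV f) -[l1](perm_preimK f) -[l2](perm_preimK f) !autf.
rewrite !(mem_imset _ _ perm_inj) (inj_eq perm_inj) => ? ? ? ? ? ? ?.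
suff -> : f @^-1: l1 = f @^-1: l2 by [].
exact: (Cmeet _ _ c ((f^-1)%g y)).
Qed.

End Automorphisms.

(** * The star of a point *)

Lemma uniq_flatten_eq (U : eqType) (ss : seq (seq U)) s1 s2 x :
  uniq (flatten ss) ->
  s1 \in ss -> s2 \in ss -> x \in s1 -> x \in s2 -> s1 = s2.
Proof.
elim: ss => //= s ss IH; rewrite cat_uniq => /and3P[_ /hasPn dis uss].
rewrite !inE => /predU1P[->|s1s] /predU1P[->|s2s] // x1 x2; last exact: IH.
  by have /negP[] := dis x (introT flattenP (ex_intro2 _ _ s2 s2s x2)).
by have /negP[] := dis x (introT flattenP (ex_intro2 _ _ s1 s1s x1)).
Qed.

(** The list [sp] holds the lines through [c], each of them without [c]: the
    geometry is read off the partition of the other points by these lines and by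
    the neighbours [nb] of [c]. *)
Section Star.
Variables (T : finType) (L : {set {set T}}) (c : T) (nb : seq T).
Variable sp : seq (seq T).

Hypothesis linesP : forall l : {set T},
  (l \in L) && (c \in l) <-> exists2 s, s \in sp & l = [set x in c :: s].
Hypothesis partition_sp : perm_eq (c :: nb ++ flatten sp) (enum T).
Hypothesis sp_neq0 : [::] \notin sp.
Hypothesis sp_gt0 : 0 < size sp.

Lemma uniq_star : uniq (c :: nb ++ flatten sp).
Proof. by rewrite (perm_uniq partition_sp) enum_uniq. Qed.

Lemma star_meet (l1 l2 : {set T}) y : l1 \in L -> l2 \in L -> c != y ->
  c \in l1 -> y \in l1 -> c \in l2 -> y \in l2 -> l1 = l2.
Proof.
move=> l1L l2L cy cl1 yl1 cl2 yl2.
have [|s1 s1sp def1] := (linesP l1).1; first by rewrite l1L.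
have [|s2 s2sp def2] := (linesP l2).1; first by rewrite l2L.
move: uniq_star; rewrite /= cat_uniq => /and4P[_ _ _ /uniq_flatten_eq usp].
move: yl1 yl2; rewrite def1 def2 !inE ![y == c]eq_sym (negbTE cy) /=.
by move=> y1 y2; rewrite (usp _ _ _ s1sp s2sp y1 y2).
Qed.

Lemma star_card : #|[set l in L | c \in l]| = size sp.
Proof.
move: uniq_star; rewrite /= mem_cat negb_or cat_uniq.
move=> /and4P[/andP[_ csp] _ _ usp].
have usps : uniq sp.
  move: sp_neq0 usp; elim: (sp) => //= s ss IH.
  rewrite inE negb_or cat_uniq => /andP[s0 ss0].
  move=> /and3P[_ /hasPn dis /(IH ss0)->].
  rewrite andbT; apply: contra s0 => sss; case: s sss dis => // x s sss dis.
  have xss : x \in flatten ss.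
    by apply/flattenP; exists (x :: s); rewrite ?mem_head.
  by have := dis x xss; rewrite mem_head.
have inj : {in sp &, injective (fun s => [set x in c :: s])}.
  move=> s1 s2 s1sp s2sp /setP eqs.
  case: s1 s1sp eqs => [|x s1] s1sp eqs; first by case/negP: sp_neq0.
  apply: (uniq_flatten_eq (x := x) usp) => //; first by rewrite inE eqxx.
  have := eqs x; rewrite !inE eqxx orbT => /esym/predU1P[xc|//].
  case/negP: csp; apply/flattenP; exists (x :: s1) => //.
  by rewrite -xc inE eqxx.
rewrite -(size_map (fun s => [set x in c :: s])).
rewrite -(card_uniqP _) ?map_inj_in_uniq //.
by apply: eq_card => l; rewrite !inE; apply/idP/mapP => /linesP.
Qed.

Lemma star_opposite : opposite L c = [set x in nb].
Proof.
apply/setP=> y; rewrite !inE.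
have colP : reflect (y = c \/ y \in flatten sp) (collinear L c y).
  apply: (iffP existsP) => [[l /and3P[lL cl yl]] | ].
    have [|s ssp def] := (linesP l).1; first by rewrite lL.
    move: yl; rewrite def !inE => /predU1P[->|ys]; [by left | right].
    by apply/flattenP; exists s.
  suff line s : s \in sp -> y = c \/ y \in s ->
      exists l : {set T}, [&& l \in L, c \in l & y \in l].
    case=> [yc | /flattenP[s ssp ys]]; last by apply: (line s); last right.
    case: (sp) sp_gt0 line => // s ? _ line.
    by apply: (line s); [apply: mem_head | left].
  move=> ssp ys; exists [set x in c :: s].
  have /andP[-> ->] := (linesP [set x in c :: s]).2 (ex_intro2 _ _ s ssp erefl).
  by rewrite !inE; case: ys => [->|->]; rewrite ?eqxx ?orbT.
have : y \in c :: nb ++ flatten sp by rewrite (perm_mem partition_sp) mem_enum.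
move: uniq_star; rewrite /= mem_cat negb_or cat_uniq.
move=> /and4P[/andP[cnb _] _ /hasPn dis _].
rewrite inE mem_cat => /or3P[/eqP yc|ynb|ysp].
- have -> : collinear L c y by apply/colP; left.
  by rewrite yc (negbTE cnb).
- rewrite ynb; apply/colP => -[yc|/dis]; last by rewrite ynb.
  by rewrite -yc ynb in cnb.
- have -> : collinear L c y by apply/colP; right.
  by rewrite (negbTE (dis y ysp)).
Qed.
End Star.

(** * Cyclic development of base blocks *)

Lemma to_nat_mod a b : 0 < N.to_nat b ->
  N.to_nat (a mod b) = N.to_nat a %% N.to_nat b.
Proof.
move=> /ltP b_gt0; have b_neq0 : b <> 0%num by lia.
rewrite {2}(N.div_mod a b b_neq0) N2Nat.inj_add N2Nat.inj_mul plusE multE.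
rewrite mulnC modnMDl modn_small //; apply/ltP.
by have := N.mod_lt a b b_neq0; lia.
Qed.

Fixpoint nrange (x : N) (k : nat) : seq N :=
  if k is k'.+1 then x :: nrange (N.succ x) k' else [::].

Lemma map_nrange x k : map N.to_nat (nrange x k) = iota (N.to_nat x) k.
Proof. by elim: k x => //= k IH x; rewrite IH N2Nat.inj_succ. Qed.

Definition shift (V d : N) (l : seq N) : seq N :=
  [seq (y + d) mod V | y <- l]%num.

(** The translate of the block [b] that takes its point [x] to [c], without [c].
    Sorting makes [undup] in [spokes] effective. *)
Definition spoke (V : N) (b : seq N) (c x : N) : seq N :=
  sort N.leb (shift V (V + c - x) (rem x b)).

(** A block that is invariant under a translation, such as that by [V / 2],
    yields the same line through [c] for several of its points, whence
    [undup]. *)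
Definition spokes (V : N) (base : seq (seq N)) (c : N) : seq (seq N) :=
  let spokes_in b := [seq spoke V b c x | x <- b & (x mod 4 == c)%num] in
  flatten [seq undup (spokes_in b) | b <- base].

(** The neighbours of [x], translated from those of the representative of [x]
    among 0, 1, 2, 3, which are listed in [nbrs]. *)
Definition nbr (V : N) (nbrs : seq (seq N)) (x : N) : seq N :=
  shift V (x - x mod 4) (nth [::] nbrs (N.to_nat (x mod 4))).

Definition block_ok (V : N) (b : seq N) : bool :=
  [&& size b == 4, uniq b & all (N.ltb^~ V) b].

(** The last condition says that [c], its neighbours and the other points of the
    lines through [c] partition the point set. *)
Definition star_ok (V : N) (r : nat) (nbrs base : seq (seq N)) (c : N) : bool :=
  let sp := spokes V base c in
  let points := c :: nth [::] nbrs (N.to_nat c) ++ flatten sp in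
  [&& size sp == r, all (fun s => size s == 3) sp &
      sort N.leb points == nrange 0 (N.to_nat V)].

(** Translates of the part of the walk from 0 to 4 connect all the multiples of
    4, and the points 1, 2 and 3 stand for the other classes. *)
Definition walk_ok (V : N) (nbrs : seq (seq N)) (w : seq N) : bool :=
  path (fun x y => y \in nbr V nbrs x) 0%num w
  && all (mem w) [:: 1; 2; 3; 4]%num.

Section Developed.
Variables (V : N) (r : nat) (nbrs base : seq (seq N)) (w : seq N).
Local Notation v := (N.to_nat V).
Hypotheses (v4 : 4 %| v) (v8 : 8 < v) (r_gt0 : 0 < r).
Hypothesis nbrs_base : {subset nbrs <= base}.
Hypothesis size_nbrs : size nbrs = 4.
Hypothesis blocks_ok : all (block_ok V) base.
Hypothesis stars_ok : all (star_ok V r nbrs base) [:: 0; 1; 2; 3]%num.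
Hypothesis walk : walk_ok V nbrs w.

Import GRing.Theory.
Local Open Scope ring_scope.
Local Notation T := 'Z_v.

Let v1 : (1 < v)%N. Proof. exact: leq_trans v8. Qed.

Definition pt (x : N) : T := (N.to_nat x)%:R.

Lemma val_pt x : pt x = (N.to_nat x %% v)%N :> nat.
Proof. exact: val_Zp_nat. Qed.

Lemma val_pt_small x : (N.to_nat x < v)%N -> pt x = N.to_nat x :> nat.
Proof. by move=> xv; rewrite val_pt modn_small. Qed.

Lemma ptD x y : pt (x + y) = pt x + pt y.
Proof. by rewrite /pt N2Nat.inj_add plusE natrD. Qed.

Lemma ptB x y : (N.to_nat y <= N.to_nat x)%N -> pt (x - y) = pt x - pt y.
Proof. by move=> le_yx; rewrite /pt N2Nat.inj_sub minusE natrB. Qed.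

Lemma pt_order : pt V = 0. Proof. exact: pchar_Zp. Qed.

Lemma pt_mod x : pt (x mod V) = pt x.
Proof. by apply: val_inj; rewrite /= !val_pt to_nat_mod ?modn_mod // ltnW. Qed.

Lemma map_pt_shift d l : map pt (shift V d l) = [seq x + pt d | x <- map pt l].
Proof. by rewrite -!map_comp; apply: eq_map => y /=; rewrite pt_mod ptD. Qed.

Lemma dvd4_add (x y : T) : (4 %| x -> 4 %| (x + y)%R = (4 %| y))%N.
Proof.
move=> x4; rewrite /dvdn /= modn_dvdm ?Zp_cast //.
by rewrite -[(_ == 0)%N]/(4 %| x + y)%N dvdn_addr.
Qed.

Lemma dvd4_opp (x : T) : (4 %| x)%N -> (4 %| (- x)%R)%N.
Proof. by move=> x4; rewrite -(dvd4_add _ x4) subrr dvdn0. Qed.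

Definition trans (h : T) : {perm T} := perm (addIr h).

Lemma transE h x : trans h x = x + h. Proof. by rewrite permE. Qed.

Definition block (b : seq N) : {set T} := [set x in map pt b].
Definition lines : {set {set T}} :=
  [set l | [exists h : T,
     (4 %| h)%N && (l \in [seq trans h @: block b | b <- base])]].

Lemma linesE l :
  reflect (exists (h : T) (b : seq N),
             [/\ (4 %| h)%N, b \in base & l = trans h @: block b])
          (l \in lines).
Proof.
rewrite inE; apply: (iffP existsP) => [[h /andP[h4 /mapP[b]]]|].
  by exists h, b.
by move=> [h [b [h4 bb ->]]]; exists h; rewrite h4 map_f.
Qed.

Lemma trans_comp h h' (l : {set T}) :
  trans h @: (trans h' @: l) = trans (h' + h) @: l.
Proof.
by rewrite -imset_comp; apply: eq_imset => x /=; rewrite !transE addrA.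
Qed.

Lemma trans0 (l : {set T}) : trans 0 @: l = l.
Proof.
by rewrite -[RHS]imset_id; apply: eq_imset => x; rewrite transE addr0.
Qed.

Lemma trans_lines (h : T) l :
  (4 %| h)%N -> l \in lines -> trans h @: l \in lines.
Proof.
move=> h4 /linesE[h' [b [h'4 bb ->]]]; apply/linesE.
by exists (h' + h), b; rewrite trans_comp dvd4_add.
Qed.

Lemma trans_aut (h : T) : (4 %| h)%N -> automorphism lines (trans h).
Proof.
move=> h4 l; apply/idP/idP => [hl|]; last exact: trans_lines.
by rewrite -[l]trans0 -(subrr h) -trans_comp trans_lines // dvd4_opp.
Qed.

Lemma base_lines b : b \in base -> block b \in lines.
Proof. by move=> bb; apply/linesE; exists 0, b; rewrite trans0. Qed.

Lemma block_okP b : b \in base ->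
  [/\ size b = 4, uniq b & forall x, x \in b -> (N.to_nat x < v)%N].
Proof.
move=> /(allP blocks_ok)/and3P[/eqP szb ub /allP ltb]; split=> // x /ltb.
by move/N.ltb_lt => ?; apply/ltP; lia.
Qed.

Lemma pt_inj x y :
  (N.to_nat x < v)%N -> (N.to_nat y < v)%N -> pt x = pt y -> x = y.
Proof.
move=> xV yV /(congr1 val); rewrite /= !val_pt_small //; by move/N2Nat.inj.
Qed.

Lemma card_lines l : l \in lines -> #|l| = 4.
Proof.
move=> /linesE[h [b [_ /block_okP[szb ub ltb] ->]]].
rewrite card_imset; last exact: perm_inj.
rewrite /block cardsE -[RHS]szb -(size_map pt); apply/card_uniqP.
by rewrite map_inj_in_uniq // => x y /ltb xV /ltb yV; apply: pt_inj.
Qed.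

(** A translation that takes [x] to [c] is by a multiple of 4 exactly when [x] is
    congruent to [c]; so each point of the class of [c] on a base block gives a
    line through [c], and no other point does. *)
Lemma dvd4_class x c (h : T) : (N.to_nat x < v)%N -> (N.to_nat c < 4)%N ->
  pt x + h = pt c -> (4 %| h)%N = (x mod 4 == c)%num.
Proof.
move=> xv c4 /(congr1 (fun t : T => t %% 4))%N.
rewrite /= modn_dvdm ?Zp_cast // -modnDml !val_pt !modn_dvdm // modnDml.
rewrite (modn_small c4) => xhc.
have -> : (x mod 4 == c)%num = (N.to_nat x %% 4 == N.to_nat c).
  rewrite -(to_nat_mod x (b := 4)) //.
  by apply/eqP/eqP => [->|/N2Nat.inj].
rewrite -xhc eq_sym.
by have := eqn_modDl (N.to_nat x) h 0 4; rewrite addn0 mod0n => ->.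
Qed.

Lemma spoke_block b c x : b \in base -> x \in b ->
  trans (pt c - pt x) @: block b = [set y in pt c :: map pt (spoke V b c x)].
Proof.
move=> bb xb; have [_ _ ltb] := block_okP bb.
have hE : pt (V + c - x) = pt c - pt x.
  rewrite ptB ?ptD ?pt_order ?add0r // N2Nat.inj_add plusE.
  by rewrite (leq_trans (ltnW (ltb x xb))) ?leq_addr.
apply/setP=> y; rewrite inE.
have -> : (y \in trans (pt c - pt x) @: block b) =
    (y \in [seq z + (pt c - pt x) | z <- map pt b]).
  by apply/imsetP/mapP => -[z]; [rewrite inE | move=> zb] => *; exists z;
     rewrite ?inE ?transE // -transE.
have /perm_mem -> : perm_eq [seq z + (pt c - pt x) | z <- map pt b]
   [seq z + (pt c - pt x) | z <- map pt (x :: rem x b)].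
  by rewrite !perm_map // perm_to_rem.
rewrite /= addrC subrK !inE; congr (_ || _).
rewrite -hE -map_pt_shift; apply: perm_mem; apply: perm_map.
by rewrite perm_sym perm_sort.
Qed.

Lemma spokesP c : (N.to_nat c < 4)%N ->
  forall l : {set T}, (l \in lines) && (pt c \in l) <->
  exists2 s, s \in map (map pt) (spokes V base c) & l = [set x in pt c :: s].
Proof.
move=> c4 l; split.
  case/andP=> /linesE[h [b [h4 bb ->]]] /imsetP[z].
  rewrite inE => /mapP[x xb ->]; rewrite transE => cE.
  have [_ _ ltb] := block_okP bb.
  have hE : h = pt c - pt x by rewrite cE addrC addKr.
  exists (map pt (spoke V b c x)); last by rewrite hE spoke_block.
  apply/map_f/flattenP.
  exists (undup [seq spoke V b c x | x <- b & (x mod 4 == c)%num]).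
    by apply/mapP; exists b.
  rewrite mem_undup; apply/map_f; rewrite mem_filter xb andbT.
  by rewrite -(dvd4_class (ltb x xb) c4 (esym cE)).
case=> _ /mapP[s /flattenP[_ /mapP[b bb ->]]] + -> ->.
rewrite mem_undup => /mapP[x]; rewrite mem_filter => /andP[cx xb] ->.
have [_ _ ltb] := block_okP bb.
rewrite -spoke_block //; apply/andP; split.
  apply: trans_lines; last exact: base_lines.
  by rewrite (dvd4_class (ltb x xb) c4) // addrC subrK.
by rewrite spoke_block // inE mem_head.
Qed.

Lemma star_okP c : (N.to_nat c < 4)%N -> star_ok V r nbrs base c.
Proof.
move=> c4; apply: (allP stars_ok).
by case: c c4 => [|[[?|?|]|[?|?|]|]] //= /ltP; lia.
Qed.

Section Base.
Variable c : N.
Hypothesis c4 : (N.to_nat c < 4)%N.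
Let nb := nth [::] nbrs (N.to_nat c).
Let sp := spokes V base c.

Lemma spokes_partition :
  perm_eq (pt c :: map pt nb ++ flatten (map (map pt) sp)) (enum T).
Proof.
have /and3P[_ _ /eqP sortE] := star_okP c4.
have /(perm_map pt) : perm_eq (c :: nb ++ flatten sp) (nrange 0 v).
  by rewrite -sortE perm_sym perm_sort.
rewrite /= map_cat map_flatten => /perm_trans; apply.
have -> : map pt (nrange 0 v) = enum T; last exact: perm_refl.
apply: (inj_map val_inj); transitivity (iota 0 v); last first.
  by rewrite val_enum_ord Zp_cast.
rewrite -[RHS](map_nrange 0) -map_comp; apply/eq_in_map => x /(map_f N.to_nat).
by rewrite map_nrange mem_iota add0n => /andP[_ xv]; apply: val_pt_small.
Qed.

Lemma spokes_neq0 : [::] \notin map (map pt) sp.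
Proof.
apply/mapP => -[s ssp]; have /and3P[_ /allP/(_ s ssp)/eqP + _] := star_okP c4.
by case: s ssp.
Qed.

Lemma size_spokes : size (map (map pt) sp) = r.
Proof. by have /and3P[/eqP <- _ _] := star_okP c4; rewrite size_map. Qed.

Lemma opposite_base : opposite lines (pt c) = block nb.
Proof.
rewrite (star_opposite (spokesP c4) spokes_partition) //.
by rewrite size_spokes.
Qed.

Lemma nth_nbrs : nb \in base.
Proof. by apply/nbrs_base/mem_nth; rewrite size_nbrs. Qed.

End Base.

Lemma trans_base x : exists c (h : T),
  [/\ (N.to_nat c < 4)%N, (4 %| h)%N & trans h (pt c) = x].
Proof.
exists (N.of_nat (x %% 4)), (4 * (x %/ 4))%:R.
split; rewrite ?Nat2N.id ?ltn_pmod //.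
  by rewrite val_Zp_nat // /dvdn modn_dvdm // -/(dvdn _ _) dvdn_mulr.
by rewrite transE /pt Nat2N.id -natrD addnC mulnC -divn_eq natr_Zp.
Qed.

Lemma lines_pentagonal : pentagonal_geometry lines 4 r.
Proof.
pose C t := exists2 c, (N.to_nat c < 4)%N & t = pt c.
apply: (pentagonal_aut (C := C)).
- exact: card_lines.
- move=> x; have [c [h [c4 h4 <-]]] := trans_base x.
  by exists (pt c), (trans h); split; [exists c | apply: trans_aut | ].
- move=> _ [c c4 ->].
  rewrite (star_card (spokesP c4) (spokes_partition c4) (spokes_neq0 c4)).
  exact: size_spokes.
- by move=> _ [c c4 ->]; rewrite opposite_base // base_lines ?nth_nbrs.
- move=> l1 l2 _ y [c c4 ->].
  by apply: (star_meet (spokesP c4) (spokes_partition c4)).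
Qed.

Lemma deficiency_nbr x y : y \in nbr V nbrs x ->
  deficiency_graph lines (pt x) (pt y).
Proof.
pose c := (x mod 4)%num; pose d := (x - c)%num.
have cE : N.to_nat c = (N.to_nat x %% 4)%N by apply: to_nat_mod.
have c4 : (N.to_nat c < 4)%N by rewrite cE ltn_pmod.
have le_cx : (N.to_nat c <= N.to_nat x)%N by rewrite cE leq_mod.
have d4 : (4 %| pt d)%N.
  rewrite val_pt /dvdn modn_dvdm // N2Nat.inj_sub minusE cE -/(dvdn _ _).
  by rewrite {1}(divn_eq (N.to_nat x) 4) addnK dvdn_mull.
have xE : pt x = trans (pt d) (pt c) by rewrite transE ptB // addrC subrK.
move=> /(map_f pt); rewrite map_pt_shift => /mapP[z znb ->].
rewrite xE -transE -in_opposite (opposite_aut _ (trans_aut d4)).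
by rewrite (mem_imset _ _ perm_inj) opposite_base // inE.
Qed.

Lemma lines_connected : connected_graph (deficiency_graph lines).
Proof.
set e := deficiency_graph lines.
have /andP[w_path w_mem] := walk.
have conn_base c : c \in [:: 1; 2; 3; 4]%num -> connect e (pt 0) (pt c).
  move=> /(allP w_mem) cw.
  have e_path : path e (pt 0) (map pt w).
    by apply: homo_path w_path => x y; apply: deficiency_nbr.
  by apply: (path_connect e_path); rewrite inE map_f ?orbT.
have conn4 k : connect e 0 (4 * k)%:R.
  elim: k => [|k IH]; first by rewrite muln0.
  apply: (connect_trans IH).
  have h4 : (4 %| ((4 * k)%:R : T))%N.
    by rewrite val_Zp_nat // /dvdn modn_dvdm // -/(dvdn _ _) dvdn_mulr.
  have := connect_aut (trans_aut h4) (conn_base 4%num isT).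
  by rewrite !transE add0r -natrD mulnS.
have conn0 t : connect e 0 t.
  have [c [h [c4 h4 <-]]] := trans_base t.
  have hE : h = (4 * (h %/ 4))%:R by rewrite mulnC divnK ?natr_Zp.
  apply: (connect_trans (conn4 (h %/ 4)%N)).
  rewrite -hE -[h in connect _ h _]add0r -transE.
  apply: connect_aut; first exact: trans_aut.
  case: (N.eq_dec c 0) => [->|c0]; first exact: connect0.
  apply: conn_base; case: c c4 c0 => [|[[?|?|]|[?|?|]|]] // /ltP; lia.
split; first by apply/card_gt0P; exists 0.
move=> x y; apply: connect_trans (conn0 y).
by rewrite (sym_connect_sym (@deficiencyC _ lines)) conn0.
Qed.

Lemma lines_girth5 : girth_at_least (deficiency_graph lines) 5.
Proof.
apply: (girth5 lines_pentagonal) => //; first exact: lines_connected.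
by rewrite card_ord Zp_cast.
Qed.
End Developed.

(** * The sixteen geometries *)

(** A core on [V] points: the neighbours of the point 0, the blocks whose orbit
    under translations is invariant under [twin], and blocks that are to be
    completed with their images under [twin]. *)
Record core := Core {
  opposite0 : seq N;
  invariant_blocks : seq (seq N);
  paired_blocks : seq (seq N) }.

(** In terms of bits, (x, a, e) |-> (x, a, e + 1): an automorphism of the
    core and of the graph, which halves the data. *)
Definition twin (x : N) : N := N.lxor x 1.

(** The neighbours of 0 are the points x = 4s + 2 + e for (s, e) in S; those of
    2 are then the points -4s + e, that is 2 + 2e - x, and [e] is the parity of
    [x].  The points 1 and 3 are the twins of 0 and 2. *)
Definition opposites (V : N) (o : seq N) : seq (seq N) :=
  let o' := [seq (V + 2 + 2 * (x mod 2) - x) mod V | x <- o]%num in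
  [:: o; map twin o; o'; map twin o'].

(** The 16 blocks (a, i), (b, j), (c, i + j), (d, i + w j) over a block
    {a, b, c, d} of Z_n.  In GF(4) = {0, 1, 2, 3}, addition is the bitwise
    exclusive or and multiplication by w = 2 permutes 1, 2, 3 cyclically. *)
Definition inflate (b : seq N) : seq (seq N) :=
  let mulw j := nth 0%num [:: 0; 2; 3; 1]%num (N.to_nat j) in
  let column i j := [:: i; j; N.lxor i j; N.lxor i (mulw j)] in
  [seq [seq 4 * xi.1 + xi.2 | xi <- zip b (column i j)]
     | i <- [:: 0; 1; 2; 3], j <- [:: 0; 1; 2; 3]]%num.

Definition base_blocks (V : N) (C : core) (D : seq (seq N)) : seq (seq N) :=
  opposites V (opposite0 C) ++ invariant_blocks C ++ paired_blocks C ++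
  map (map twin) (paired_blocks C) ++ flatten (map inflate D).

(** The [tour] encodes a walk from 0: its entries are the positions of the
    successive vertices in the lists of neighbours of their predecessors. *)
Record blueprint := Blueprint {
  valency : nat;
  core_of : N -> core;
  difference_family : seq (seq N);
  tour : seq nat }.

Definition follow (V : N) (nbrs : seq (seq N)) (ds : seq nat) : seq N :=
  scanl (fun x d => nth 0%num (nbr V nbrs x) d) 0%num ds.

Definition valid (g : blueprint) : bool :=
  let r := valency g in
  let V := N.of_nat (3 * r + 5) in
  let C := core_of g V in
  let nbrs := opposites V (opposite0 C) in
  let base := base_blocks V C (difference_family g) in
  [&& 4 %| 3 * r + 5, 8 < 3 * r + 5, all (block_ok V) base,
      all (star_ok V r nbrs base) [:: 0; 1; 2; 3]%num &
      walk_ok V nbrs (follow V nbrs (tour g))].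

Lemma valid_geometry g : valid g ->
  exists (T : finType) (L : {set {set T}}),
    [/\ pentagonal_geometry L 4 (valency g),
        connected_graph (deficiency_graph L) &
        girth_at_least (deficiency_graph L) 5].
Proof.
rewrite /valid; set r := valency g; set V := N.of_nat _.
set nbrs := opposites V _; set base := base_blocks V _ _.
move=> /and5P[v4 v8 blocks_ok stars_ok walk].
have vE : N.to_nat V = 3 * r + 5 by rewrite Nat2N.id.
have r_gt0 : 0 < r by case: (r) v8.
rewrite -vE in v4 v8.
have nbrs_base : {subset nbrs <= base} by move=> b; rewrite mem_cat => ->.
exists 'Z_(N.to_nat V), (lines V base); split.
- exact: lines_pentagonal stars_ok.
- exact: lines_connected stars_ok walk.
- exact: lines_girth5 stars_ok walk.
Qed.

(** For odd [n]: the differences at distance at most 8 from [0]. *)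
Definition core_window8 (V : N) : core :=
  (Core
    [:: 2; V - 25; V - 1; V - 18]
    [:: [:: 0; 1; 34; 35]]
    [:: [:: 3; 16; 20; 32]; [:: 1; 15; 27; 29]; [:: 3; 12; 33; 34];
        [:: 0; 11; 27; 32]; [:: 1; 9; 22; 32]; [:: 0; 7; 13; 30];
        [:: 1; 11; 19; 30]; [:: 3; 7; 29; 35]])%num.

(** For odd [n]: the differences at distance at most 11 from [0]. *)
Definition core_window11 (V : N) : core :=
  (Core
    [:: 2; V - 21; V - 26; V - 42]
    [:: [:: 0; 1; 42; 43]]
    [:: [:: 3; 5; 36; 44]; [:: 0; 27; 38; 45]; [:: 3; 11; 41; 46];
        [:: 2; 29; 35; 36]; [:: 2; 12; 24; 41]; [:: 2; 13; 33; 42];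
        [:: 0; 4; 26; 40]; [:: 0; 24; 37; 47]; [:: 1; 15; 35; 47];
        [:: 1; 14; 18; 33]; [:: 2; 8; 26; 43]; [:: 0; 3; 30; 39]])%num.

(** For even [n]: the differences at distance at most 5 from [0] or at most 4
    from [n / 2]; adding [h] to a point adds [n / 2] to its first coordinate. *)
Definition core_windows5_4 (V : N) : core :=
  let h := (V / 2)%num in
  (Core
    [:: 2; 6; V - 9; h - 5]
    [:: [:: 0; 1; h; h + 1]; [:: 2; 3; h + 2; h + 3]]
    [:: [:: h + 2; 5; 10; h + 21]; [:: h + 2; h + 4; h + 16; 19];
        [:: 2; h + 8; h + 16; 22]; [:: 0; h + 2; h + 17; h + 18];
        [:: h + 3; h + 11; 13; h + 21]; [:: 1; h + 6; 18; 21];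
        [:: 1; 4; 14; 20]; [:: h + 2; h + 9; 18; h + 23];
        [:: h + 1; 4; 13; h + 23]; [:: h + 1; h + 10; h + 19; h + 22]])%num.

(** For even [n]: the differences at distance at most 6 from [0] or from
    [n / 2]. *)
Definition core_windows6_6 (V : N) : core :=
  let h := (V / 2)%num in
  (Core
    [:: 2; V - 17; V - 22; h - 1]
    [:: [:: 0; 27; h + 1; h + 26]; [:: 0; 1; h - 10; h - 9]]
    [:: [:: 2; 10; 22; h - 2]; [:: 0; 15; h + 7; h + 22];
        [:: 0; 9; h + 19; V - 6]; [:: 0; 8; 20; h + 23];
        [:: 0; 10; 26; h + 17]; [:: 0; 3; h - 24; V - 15];
        [:: 0; 16; h - 4; h + 18]; [:: 0; 23; 25; h + 6];
        [:: 0; 6; h + 12; V - 11]; [:: 0; h - 22; h - 18; h - 11];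
        [:: 0; 4; 11; V - 14]; [:: 0; h - 21; h - 14; V - 1];
        [:: 0; h - 13; h - 2; h + 8]; [:: 0; 14; h; h + 14]])%num.

(** For small [n] the core covers a set of differences that is not a union of
    two intervals, so it belongs to a single [n]. *)
Definition core32 (_ : N) : core :=
  (Core
    [:: 2; 22; 126; 19]
    [:: [:: 0; 18; 65; 83]; [:: 0; 1; 6; 7]]
    [:: [:: 0; 51; 64; 115]; [:: 0; 45; 111; 127]; [:: 0; 16; 48; 75];
        [:: 0; 26; 49; 99]; [:: 0; 34; 67; 114]; [:: 0; 15; 33; 56];
        [:: 0; 14; 86; 98]; [:: 0; 12; 35; 58]; [:: 0; 74; 106; 119];
        [:: 0; 3; 13; 84]])%num.

Definition core44 (_ : N) : core :=
  (Core
    [:: 2; 114; 151; 86]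
    [:: [:: 0; 1; 70; 71]; [:: 0; 75; 89; 162]]
    [:: [:: 2; 11; 23; 34]; [:: 0; 26; 34; 142]; [:: 0; 111; 150; 170];
        [:: 0; 11; 94; 118]; [:: 0; 130; 147; 163]; [:: 0; 38; 87; 109];
        [:: 0; 39; 49; 110]; [:: 0; 3; 117; 131]; [:: 0; 19; 105; 155];
        [:: 0; 20; 41; 115]; [:: 0; 9; 42; 146]; [:: 0; 10; 48; 164];
        [:: 0; 17; 85; 106]; [:: 0; 15; 33; 51]; [:: 0; 8; 24; 167];
        [:: 0; 13; 43; 153]; [:: 0; 27; 32; 136]; [:: 0; 31; 88; 119]])%num.

Definition core56 (_ : N) : core :=
  (Core
    [:: 2; 151; 207; 75]
    [:: [:: 0; 1; 22; 23]; [:: 0; 3; 113; 114]]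
    [:: [:: 0; 35; 131; 211]; [:: 0; 66; 99; 115]; [:: 0; 48; 98; 129];
        [:: 0; 17; 147; 192]; [:: 0; 8; 18; 160]; [:: 0; 9; 67; 219];
        [:: 0; 154; 163; 171]; [:: 0; 19; 74; 204]; [:: 0; 44; 95; 101];
        [:: 0; 33; 96; 133]; [:: 0; 36; 162; 182]; [:: 0; 11; 47; 80];
        [:: 0; 38; 103; 135]; [:: 0; 34; 127; 181]; [:: 0; 59; 102; 183];
        [:: 0; 46; 83; 206]; [:: 0; 16; 150; 194]; [:: 0; 78; 112; 190]])%num.

Definition core68 (_ : N) : core :=
  (Core
    [:: 2; 94; 251; 70]
    [:: [:: 0; 1; 18; 19]; [:: 0; 46; 137; 183]]
    [:: [:: 0; 87; 214; 259]; [:: 0; 30; 145; 246]; [:: 0; 28; 84; 258];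
        [:: 0; 31; 47; 218]; [:: 0; 17; 44; 175]; [:: 0; 57; 118; 173];
        [:: 0; 86; 119; 146]; [:: 0; 147; 191; 206]; [:: 0; 34; 62; 190];
        [:: 0; 16; 61; 205]; [:: 0; 27; 215; 240]; [:: 0; 33; 163; 192];
        [:: 0; 26; 160; 231]; [:: 0; 35; 100; 195]; [:: 0; 3; 58; 193];
        [:: 0; 60; 162; 242]; [:: 0; 83; 115; 194]; [:: 0; 114; 136; 250]])%num.

Definition core86 (_ : N) : core :=
  (Core
    [:: 2; 235; 319; 343]
    [:: [:: 0; 1; 154; 155]; [:: 0; 66; 173; 239]]
    [:: [:: 2; 10; 99; 226]; [:: 0; 26; 187; 218]; [:: 0; 67; 128; 227];
        [:: 0; 27; 123; 152]; [:: 0; 35; 184; 249]; [:: 0; 9; 129; 258];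
        [:: 0; 28; 60; 313]; [:: 0; 7; 96; 321]; [:: 0; 92; 254; 318];
        [:: 0; 31; 88; 282]; [:: 0; 34; 62; 94]; [:: 0; 11; 234; 257];
        [:: 0; 10; 168; 232]; [:: 0; 8; 179; 185]; [:: 0; 163; 314; 339];
        [:: 0; 250; 259; 342]; [:: 0; 4; 90; 178]; [:: 0; 3; 109; 115];
        [:: 0; 110; 114; 175]; [:: 0; 63; 85; 170]; [:: 0; 95; 153; 262];
        [:: 0; 91; 172; 263]])%num.

Definition core98 (_ : N) : core :=
  (Core
    [:: 2; 78; 38; 115]
    [:: [:: 2; 3; 198; 199]; [:: 0; 1; 196; 197]]
    [:: [:: 0; 17; 88; 219]; [:: 0; 43; 290; 323]; [:: 0; 91; 267; 283];
        [:: 0; 130; 203; 235]; [:: 0; 34; 162; 266]; [:: 0; 18; 106; 305];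
        [:: 0; 19; 57; 129]; [:: 0; 75; 90; 104]; [:: 0; 35; 105; 355];
        [:: 0; 16; 179; 280]; [:: 0; 32; 74; 232]; [:: 0; 114; 201; 379];
        [:: 0; 47; 147; 338]; [:: 0; 59; 103; 146]; [:: 0; 44; 102; 350];
        [:: 0; 100; 294; 351]; [:: 0; 45; 144; 362]; [:: 0; 3; 23; 374];
        [:: 0; 39; 198; 375]; [:: 0; 22; 56; 217]; [:: 0; 20; 41; 359];
        [:: 0; 33; 79; 176]])%num.

Definition blueprints : seq blueprint :=
  [:: Blueprint 41 core32
     [:: [:: 0; 7; 17; 30]]%num
     [:: 0; 2; 3; 1; 0];
   Blueprint 57 core44
     [:: [:: 0; 1; 14; 25]]%num
     [:: 0; 1; 3; 2; 0; 0; 1; 0; 1; 2; 1; 2; 1; 2];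
   Blueprint 73 core56
     [:: [:: 0; 15; 49; 50]; [:: 0; 17; 43; 46]]%num
     [:: 0; 1; 0; 3; 3; 1; 3; 0];
   Blueprint 89 core68
     [:: [:: 0; 3; 44; 66]; [:: 0; 10; 26; 59]; [:: 0; 1; 38; 56]]%num
     [:: 0; 1; 3; 2; 0; 0; 1; 0; 1; 0; 3; 2];
   Blueprint 113 core86
     [:: [:: 0; 26; 29; 39]; [:: 0; 25; 66; 77]; [:: 0; 12; 31; 81];
         [:: 0; 14; 49; 82]]%num
     [:: 0; 2; 0; 2; 0; 2; 1; 2; 0; 3];
   Blueprint 121 core_windows5_4
     [:: [:: 0; 41; 62; 75]; [:: 0; 29; 56; 68]; [:: 0; 55; 66; 86];
         [:: 0; 57; 76; 85]; [:: 0; 59; 69; 84]; [:: 0; 38; 60; 78]]%num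
     [:: 0; 0; 1; 0; 3; 2; 3; 0];
   Blueprint 129 core98
     [:: [:: 0; 3; 27; 42]; [:: 0; 23; 57; 78]; [:: 0; 51; 53; 86];
         [:: 0; 6; 37; 97]; [:: 0; 17; 30; 46]]%num
     [:: 0; 1; 3; 2; 0; 0; 1; 2; 1; 3];
   Blueprint 137 core_windows5_4
     [:: [:: 0; 57; 83; 90]; [:: 0; 62; 81; 94]; [:: 0; 36; 66; 77];
         [:: 0; 70; 86; 98]; [:: 0; 35; 64; 95]; [:: 0; 59; 79; 96];
         [:: 0; 43; 65; 89]]%num
     [:: 0; 0; 1; 0; 3; 2; 3; 0];
   Blueprint 153 core_windows5_4
     [:: [:: 0; 43; 79; 106]; [:: 0; 46; 91; 110]; [:: 0; 81; 95; 103];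
         [:: 0; 47; 76; 88]; [:: 0; 66; 96; 105]; [:: 0; 48; 74; 92];
         [:: 0; 78; 93; 109]; [:: 0; 34; 67; 99]]%num
     [:: 0; 0; 1; 0; 3; 2; 3; 0];
   Blueprint 161 core_windows6_6
     [:: [:: 0; 39; 72; 107]; [:: 0; 69; 92; 105]; [:: 0; 76; 94; 110];
         [:: 0; 77; 98; 108]; [:: 0; 74; 85; 114]; [:: 0; 73; 95; 115];
         [:: 0; 52; 78; 103]; [:: 0; 43; 81; 90]]%num
     [:: 0; 1; 0; 1; 0; 1; 0; 1; 0; 2; 0; 2; 0; 2; 0; 2; 0; 2; 0; 2; 3; 2; 0;
         0; 1; 2];
   Blueprint 169 core_windows5_4
     [:: [:: 0; 51; 76; 120]; [:: 0; 50; 71; 108]; [:: 0; 47; 93; 119];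
         [:: 0; 83; 94; 122]; [:: 0; 85; 101; 115]; [:: 0; 88; 106; 121];
         [:: 0; 49; 87; 97]; [:: 0; 75; 99; 111]; [:: 0; 54; 86; 109]]%num
     [:: 0; 0; 1; 0; 3; 2; 3; 0];
   Blueprint 177 core_windows6_6
     [:: [:: 0; 52; 100; 112]; [:: 0; 57; 89; 116]; [:: 0; 53; 83; 111];
         [:: 0; 92; 105; 125]; [:: 0; 78; 99; 115]; [:: 0; 98; 109; 124];
         [:: 0; 44; 87; 94]; [:: 0; 79; 96; 120]; [:: 0; 49; 95; 103]]%num
     [:: 0; 1; 0; 1; 0; 1; 0; 1; 0; 2; 0; 2; 0; 2; 0; 2; 0; 2; 0; 2; 0; 2; 3;
         2; 0; 0; 1; 2];
   Blueprint 181 core_window8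
     [:: [:: 0; 47; 81; 116]; [:: 0; 70; 94; 121]; [:: 0; 71; 84; 126];
         [:: 0; 65; 111; 128]; [:: 0; 54; 79; 115]; [:: 0; 85; 108; 122];
         [:: 0; 45; 78; 109]; [:: 0; 57; 98; 117]; [:: 0; 49; 89; 99];
         [:: 0; 75; 107; 119]]%num
     [:: 0; 0; 2; 0; 3; 1; 2; 0];
   Blueprint 189 core_window11
     [:: [:: 0; 51; 83; 122]; [:: 0; 48; 94; 118]; [:: 0; 59; 102; 128];
         [:: 0; 68; 101; 123]; [:: 0; 50; 87; 127]; [:: 0; 78; 116; 130];
         [:: 0; 54; 85; 115]; [:: 0; 67; 90; 124]; [:: 0; 45; 81; 125];
         [:: 0; 79; 114; 126]]%num
     [:: 0; 1; 3; 1; 2; 1; 0];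
   Blueprint 193 core_windows6_6
     [:: [:: 0; 46; 89; 112]; [:: 0; 81; 109; 133]; [:: 0; 61; 87; 125];
         [:: 0; 63; 104; 114]; [:: 0; 96; 116; 127]; [:: 0; 102; 119; 131];
         [:: 0; 86; 121; 139]; [:: 0; 58; 97; 113]; [:: 0; 54; 101; 110];
         [:: 0; 84; 124; 132]]%num
     [:: 0; 1; 0; 1; 0; 1; 0; 1; 0; 2; 0; 2; 0; 2; 0; 2; 0; 2; 0; 2; 0; 2; 0;
         2; 3; 2; 0; 0; 1; 2];
   Blueprint 197 core_window8
     [:: [:: 0; 47; 85; 121]; [:: 0; 62; 81; 138]; [:: 0; 77; 126; 136];
         [:: 0; 58; 88; 129]; [:: 0; 103; 125; 134]; [:: 0; 48; 93; 114];
         [:: 0; 84; 117; 135]; [:: 0; 55; 99; 115]; [:: 0; 69; 106; 132];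
         [:: 0; 53; 95; 120]; [:: 0; 70; 110; 122]]%num
     [:: 0; 0; 2; 0; 3; 1; 2; 0]].


Lemma valid_valency gs r :
  all valid gs -> r \in map valency gs -> exists2 g, valid g & r = valency g.
Proof.
elim: gs => //= g gs IH /andP[vg vgs]; rewrite inE => /predU1P[->|].
  by exists g.
exact: IH.
Qed.

Lemma blueprints_valid : all valid blueprints.
Proof. by vm_compute. Qed.

Theorem lemma6p7 (r : nat)
  (hr : r \in [:: 41; 57; 73; 89; 113; 121; 129; 137; 153; 161; 169; 177; 181;
                 189; 193; 197]) :
  exists (T : finType) (L : {set {set T}}),
    [/\ pentagonal_geometry L 4 r,
        connected_graph (deficiency_graph L) &
        girth_at_least (deficiency_graph L) 5].
Proof.
have rIn : r \in map valency blueprints by [].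
by have [g vg ->] := valid_valency blueprints_valid rIn; apply: valid_geometry.
Qed.
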